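(* Let $1<p<\infty$, $1\le q<\infty$, $p\ne q$. Let $1=b_1>b_2>\cdots>b_n>b_{n+1}>\cdots>0$ with $b_n\to0$, and suppose that $\mu(A_n):=b_n-b_{n+1}\ge\mu(A_{n+1}):=b_{n+1}-b_{n+2}$ for all $n$. Let $B_n=\|\chi_{(b_{n+1},b_n]}\|_{p,q}=(b_n-b_{n+1})^{1/p}$. Then the sequence $\{B_n^{-1}\chi_{(b_{n+1},b_n]}\}_{n=1}^\infty$ in $L_{p,q}(0,1)$ is equivalent to the unit vector basis $\{e_n^{\ell_q}\}$ of $\ell_q$ if $\sup_n\frac{b_{n+1}}{b_n}<1$. In particular, $\ell_{p,q}(\{A_n\})$ is isomorphic to $\ell_q$ if $\sup_k\frac{\mu(A_{k+1})}{\mu(A_k)}<1$. On the other hand, if $\lim_{n\to\infty}\frac{b_{n+1}}{b_n}=1$, then $\{B_n^{-1}\chi_{(b_{n+1},b_n]}\}_{n=1}^\infty$ in $L_{p,q}(0,1)$ is not equivalent to $\{e_n^{\ell_q}\}$.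
   Context: For a $\sigma$-finite measure space $(\Omega,\Sigma,\mu)$, $1<p<\infty$ and $1\le q<\infty$, $L_{p,q}(\Omega)$ is the space of (classes of) real measurable functions $f$ with $\|f\|_{p,q}=\left(\int_0^\infty f^*(t)^q\,d(t^{q/p})\right)^{1/q}<\infty$, where $f^*(t)=\inf\{s>0:\mu(\{|f|>s\})\le t\}$. If $q\le p$ this is a norm; if $q>p$ it is a complete quasi-norm equivalent to a complete norm. $L_{p,q}(0,1)$ uses Lebesgue measure. $\ell_{p,q}(\{A_n\})$ denotes $L_{p,q}(\Omega)$ where $\Omega$ is a purely atomic measure space whose atoms are $A_n$, $n\ge1$, with the given measures $\mu(A_n)$. $\chi_A$ is the indicator function of $A$. Two sequences $\{x_n\}$ and $\{y_n\}$ (in possibly different spaces) are equivalent if there are constants $0<c\le C<\infty$ with $c\|\sum a_ny_n\|\le\|\sum a_nx_n\|\le C\|\sum a_ny_n\|$ for all finitely supported scalar sequences $(a_n)$. *)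

(* Defs.v *)
From HB Require Import structures.
From mathcomp Require Import all_boot all_order all_algebra.
From mathcomp Require Import all_classical all_reals all_analysis.

Set Implicit Arguments.
Unset Strict Implicit.
Unset Printing Implicit Defensive.

Import Order.TTheory GRing.Theory Num.Theory.
Import numFieldNormedType.Exports.

Local Open Scope classical_set_scope.
Local Open Scope ring_scope.

(* t |-> t^r on [0, +oo[, extended by 0 to the left. The test 0 < r only
   serves to make this a cumulative function for every value of r. *)
Definition cumul_pow (R : realType) (r : R) (t : R) : R :=
  if 0 < r then (Num.max 0 t) `^ r else 0.

Section cumul_pow_is_cumulative.
Context {R : realType} (r : R).

Let cumul_pow_nd : nondecreasing (cumul_pow r).
Proof.
move=> x y xy; rewrite /cumul_pow; case: ifPn => // r0.
have ge0 (z : R) : 0 <= Num.max 0 z by rewrite le_max lexx.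
apply: (ge0_ler_powR (ltW r0)); rewrite ?nnegrE ?ge0//.
by rewrite ge_max ge0 le_max xy orbT.
Qed.

Let cumul_pow_rc : right_continuous (cumul_pow r).
Proof.
move=> x; rewrite /cumul_pow /=; case: ifPn => r0; last exact: cvg_cst.
have [x0|x0|->] := ltgtP x 0.
- apply: cvg_at_right_filter; apply: cvg_near_cst.
  near=> t; rewrite max_l//; near: t.
  exact: lt_le_nbhsl.
- apply: cvg_at_right_filter.
  apply: (@cvg_trans _ (expR (r * ln t) @[t --> x])).
    apply: near_eq_cvg; near=> t.
    have t0 : 0 < t by near: t; exact: lt_nbhsr.
    by rewrite max_r ?ltW// /powR gt_eqF.
  rewrite /powR gt_eqF//.
  apply: (@cvg_comp _ _ _ (fun t => r * ln t) expR _ (nbhs (r * ln x))).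
    by apply: cvgM; [exact: cvg_cst|exact: continuous_ln].
  exact: continuous_expR.
- rewrite powR0 ?gt_eqF//.
  apply: cvg_trans (powR_cvg0 r0); apply: near_eq_cvg.
  near=> t; rewrite max_r//; near: t; exact: nbhs_right_ge.
Unshelve. all: by end_near. Qed.

HB.instance Definition _ :=
  isCumulative.Build R _ R (cumul_pow r) cumul_pow_nd cumul_pow_rc.

End cumul_pow_is_cumulative.

(* A (quasi-)normed space of classes: vectors of an ambient space satisfying
   [qmem], two of them being identified when [qeq] holds. *)
Record quasi_space (R : realType) := QuasiSpace {
  qcar :> lmodType R ;
  qmem : set qcar ;
  qeq : qcar -> qcar -> Prop ;
  qnorm : qcar -> \bar R }.

Section spaces.
Context {R : realType}.

Definition rearrangement d (T : measurableType d)
    (mu : {measure set T -> \bar R}) (f : T -> R) (t : R) : \bar R :=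
  ereal_inf [set s%:E | s in
    [set s : R | 0 < s /\ (mu [set x | (s < `|f x|)%R] <= t%:E)%E]].

Definition lorentz_norm d (T : measurableType d)
    (mu : {measure set T -> \bar R}) (p q : R) (f : T -> R) : \bar R :=
  ((\int[lebesgue_stieltjes_measure (cumul_pow (q / p))]_(t in `]0%R, +oo[)
      (rearrangement mu f t `^ q)) `^ q^-1)%E.

Definition lorentz d (T : measurableType d)
    (mu : {measure set T -> \bar R}) (p q : R) : quasi_space R :=
  @QuasiSpace R (T -> R^o)
    [set f | measurable_fun setT (f : T -> R) /\
             (lorentz_norm mu p q f < +oo)%E]
    (fun f g => (f : T -> R) = g %[ae mu])
    (lorentz_norm mu p q).

(* Functions on (0, 1) are represented by functions on R, taken modulo
   equality almost everywhere on (0, 1). *)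
Definition lorentz01 (p q : R) : quasi_space R :=
  lorentz (mrestr (@lebesgue_measure R) (measurable_itv `]0%R, 1%R[)) p q.

Definition ell (q : R) : quasi_space R :=
  @QuasiSpace R (nat -> R^o)
    [set a | ('N[counting]_(q%:E)[EFin \o (a : nat -> R)] < +oo)%E]
    eq
    (fun a => 'N[counting]_(q%:E)[EFin \o (a : nat -> R)]%E).

Definition ell_unit (q : R) (n : nat) : ell q := fun k => (k == n)%:R.

Definition equivalent_seq (X Y : quasi_space R) (x : nat -> X) (y : nat -> Y) :=
  exists c C : R, [/\ 0 < c, c <= C &
    forall (n : nat) (a : nat -> R),
      (c%:E * qnorm (\sum_(i < n) a i *: y i)%R
         <= qnorm (\sum_(i < n) a i *: x i)%R
         <= C%:E * qnorm (\sum_(i < n) a i *: y i)%R)%E].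

(* A linear bijection between the spaces of classes, continuous together with
   its inverse. *)
Definition isomorphic (X Y : quasi_space R) :=
  exists phi : X -> Y,
    [/\ forall f, qmem f -> qmem (phi f),
        forall f g, qmem f -> qmem g -> (qeq f g <-> qeq (phi f) (phi g)),
        forall (a : R) f g, qmem f -> qmem g ->
          qeq (phi (a *: f + g)) (a *: phi f + phi g),
        forall h, qmem h -> exists2 f, qmem f & qeq (phi f) h &
        exists c C : R, [/\ 0 < c, 0 < C & forall f, qmem f ->
          (c%:E * qnorm f <= qnorm (phi f) <= C%:E * qnorm f)%E]].

Definition is_atom d (T : measurableType d)
    (mu : {measure set T -> \bar R}) (A : set T) :=
  [/\ measurable A, (0 < mu A)%E &
      forall E, measurable E -> E `<=` A -> mu E = 0%E \/ mu (A `\` E) = 0%E].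

Definition purely_atomic d (T : measurableType d)
    (mu : {measure set T -> \bar R}) (A : nat -> set T) :=
  [/\ forall n, is_atom mu (A n), trivIset setT A &
      mu (~` \bigcup_n A n) = 0%E].

End spaces.

(* Main.v *)
Require Import Defs.
From HB Require Import structures.
From mathcomp Require Import all_boot all_order all_algebra.
From mathcomp Require Import all_classical all_reals all_analysis.
From mathcomp Require Import measurable_realfun.

Set Implicit Arguments.
Unset Strict Implicit.
Unset Printing Implicit Defensive.

Import Order.TTheory GRing.Theory Num.Theory.
Import numFieldNormedType.Exports.

Local Open Scope classical_set_scope.
Local Open Scope ring_scope.

(** Let [m_n = b_n - b_(n+1)], [e = q / p], let [f] be equal to [y_n] almost
everywhere on the block [A_n] of measure [m_n], and let [f*] be its decreasing
rearrangement. Since [b_n] is the measure of [A_n], [A_(n+1)], ... together,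
exceeding [max_(k < n) |y_k|] is possible for [f] only on a set of measure at
most [b_n], so that for all [t > 0]

  [f*(t)^q <= sum_k |y_k|^q 1_(0 < t <= b_k)],

and integrating against [d(t^e)] gives [||f||^q <= sum_k |y_k|^q b_k^e].
Conversely [f*(t) >= |y_n|] for [t < m_n]. If [b_(n+1) <= r b_n] with [r < 1],
then [m_n >= (1 - r) b_n], so the disjoint intervals [(K b_(k+1), K b_k]] with
[K = (1 - r) / 2] satisfy

  [f*(t)^q >= sum_k |y_k|^q 1_(K b_(k+1) < t <= K b_k)],

and integrating gives
[||f||^q >= K^e sum_k |y_k|^q (b_k^e - b_(k+1)^e) >= c sum_k |y_k|^q b_k^e].
As [b_k] and [m_k] are comparable, [||f||^q] is comparable to
[sum_k |y_k|^q m_k^e], the [q]-th power of the [ell_q] norm of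
[(y_n m_n^(1/p))_n] ([lorentz_norm_equiv_ell]). This holds on every measure
space. On the unit interval it is the equivalence of the normalized indicators
with the unit vectors ([blocks_equivalent_ell]). On a purely atomic space every
measurable function is almost everywhere constant on each atom
([atom_ae_cst]), and [f |-> (y_n m_n^(1/p))_n] is the isomorphism
([lorentz_atomic_isomorphic_ell]); there a bound on the ratios of consecutive
gaps passes to the [b_n], which are sums of gaps ([ratio_gap_ratio]).

If [b_(n+1) / b_n] tends to 1, the sum of the blocks [n], ..., [n + k - 1] is
an indicator, of norm [S^(1/p)] with [S = b_n - b_(n+k)], whereas its
coefficients have [ell_q] norm [(sum_i m_i^e)^(1/q)]. All these [m_i] are at
most [m_n], and [m_n / S] is small once [b_(n+k) <= b_n / 2], so
[sum_i m_i^e] is much larger than [S^e] when [e < 1] and much smaller when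
[e > 1] ([blocks_not_equivalent_ell]). *)

(** * Integration against the measure with distribution function t^e *)

(** A nonnegative integral is a supremum over the simple functions below the
integrand, hence monotone for arbitrary functions. Rearrangements are compared
with step functions through this lemma. *)
Lemma ge0_le_integral_nonmeasurable d (T : measurableType d) (R : realType)
    (mu : {measure set T -> \bar R}) (D : set T) (f g : T -> \bar R) :
  (forall x, D x -> 0 <= f x)%E -> (forall x, D x -> f x <= g x)%E ->
  (\int[mu]_(x in D) f x <= \int[mu]_(x in D) g x)%E.
Proof.
move=> f0 fg; rewrite !(integral_mkcond D).
have g0 x : D x -> (0 <= g x)%E.
  by move=> Dx; exact: le_trans (f0 _ Dx) (fg _ Dx).
rewrite !ge0_integralTE; [|exact: erestrict_ge0..].
apply: le_ereal_sup => _ /= [h hf <-]; exists h => // x.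
exact: le_trans (hf x) (lee_restrict fg x).
Qed.

Lemma powR_lt1 (R : realType) (x e : R) : 0 <= x -> x < 1 -> 0 < e ->
  x `^ e < 1.
Proof.
move=> x0 x1 e0; have <- : 1 `^ e = 1 :> R by rewrite powR1.
by apply: gt0_ltr_powR; rewrite ?nnegrE.
Qed.

Section stieltjes.
Context {R : realType}.
Local Notation nu e := (lebesgue_stieltjes_measure (cumul_pow (R := R) e)).

Lemma stieltjes_pow_itvoc (e u v : R) : 0 < e -> 0 <= u -> u <= v ->
  nu e `]u, v] = (v `^ e - u `^ e)%:E.
Proof.
move=> e0 u0 uv.
rewrite /lebesgue_stieltjes_measure /measure_extension/=.
rewrite measurable_mu_extE/= ?wlength_itv_bnd//; last exact: is_ocitv.
by rewrite /cumul_pow e0 !max_r// (le_trans u0).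
Qed.

(** The endpoint [c] carries no mass because [t^e] is continuous: the intervals
[(0, s c]] with [s < 1] already exhaust the measure [c^e]. *)
Lemma stieltjes_pow_itvoo (e c : R) : 0 < e -> 0 <= c ->
  nu e `]0, c[ = (c `^ e)%:E.
Proof.
move=> e0 c0; have e1 : e^-1 * e = 1 by rewrite mulVf// gt_eqF.
apply/eqP; rewrite eq_le; apply/andP; split.
  apply: (@le_trans _ _ (nu e `]0, c])).
    by apply: le_measure; rewrite ?inE//; apply: subset_itvl; rewrite bnd_simp.
  by rewrite stieltjes_pow_itvoc// powR0 ?gt_eqF// subr0.
have [->|cn0] := eqVneq c 0; first by rewrite powR0 ?gt_eqF// measure_ge0.
have {cn0 c0}c0 : 0 < c by rewrite lt_neqAle eq_sym cn0.
apply/lee_mul01Pr; first by rewrite lee_fin powR_ge0.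
move=> r /andP[r0 r1].
have s0 : 0 < r `^ e^-1 by rewrite powR_gt0.
have s1 : r `^ e^-1 < 1.
  by apply: powR_lt1; rewrite ?invr_gt0// ltW.
(* r * c^e is the measure of the interval from 0 to r^(1/e) * c *)
rewrite -EFinM -[r in (r * _)%:E]powRr1 ?(ltW r0)// -e1 powRrM.
rewrite -powRM ?(ltW s0) ?(ltW c0)//.
rewrite -[X in X%:E]subr0 -[X in (_ - X)%:E](@powR0 _ e) ?gt_eqF//.
rewrite -stieltjes_pow_itvoc ?lexx// ?mulr_ge0 ?(ltW s0) ?(ltW c0)//.
apply: le_measure; rewrite ?inE//.
by apply: subset_itvl; rewrite bnd_simp gtr_pMl.
Qed.

Lemma integral_sum_indic (e : R) (z u v : nat -> R) : 0 < e ->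
  (forall n, 0 <= z n) -> (forall n, 0 <= u n) -> (forall n, u n <= v n) ->
  (\int[nu e]_(t in `]0%R, +oo[)
     (\sum_(k <oo) (z k)%:E * (\1_(`]u k, v k]) t)%:E) =
   \sum_(k <oo) (z k * (v k `^ e - u k `^ e))%:E)%E.
Proof.
move=> e0 z0 u0 uv.
rewrite integral_nneseries//; last 2 first.
- move=> k; apply: measurable_funeM; apply/measurable_EFinP.
  exact: measurable_indic.
- by move=> k t _; rewrite mule_ge0// lee_fin// indicE ler0n.
apply: eq_eseriesr => k _.
rewrite ge0_integralZl_EFin//; last first.
  by apply/measurable_EFinP; exact: measurable_indic.
rewrite integral_indic// setIidl; first by rewrite /= stieltjes_pow_itvoc.
by move=> t /=; rewrite !in_itv/= andbT => /andP[ut _]; exact: le_lt_trans ut.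
Qed.

End stieltjes.

(** * Rearrangements and the norm of an indicator *)

Section rearrangement.
Context {R : realType} d (T : measurableType d).
Variable mu : {measure set T -> \bar R}.
Implicit Types (f : T -> R) (A B : set T).

Lemma rearrangement_ge0 f t : (0 <= rearrangement mu f t)%E.
Proof.
by apply: le_ereal_inf_tmp => _ /= [s [s0 _] <-]; rewrite lee_fin ltW.
Qed.

Lemma rearrangement_le f t (s : R) : 0 < s ->
  (mu [set x | (s < `|f x|)%R] <= t%:E)%E -> (rearrangement mu f t <= s%:E)%E.
Proof. by move=> s0 fs; apply: ereal_inf_lbound; exists s. Qed.

Lemma rearrangement_ge f t (u : R) :
  (forall s : R, 0 < s -> s < u -> (t%:E < mu [set x | (s < `|f x|)%R])%E) ->
  (u%:E <= rearrangement mu f t)%E.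
Proof.
move=> H; apply: le_ereal_inf_tmp => _ /= [s [s0 fs] <-]; rewrite lee_fin leNgt.
by apply/negP => /(H s s0); rewrite ltNge fs.
Qed.

Lemma le_measure_ae A B : measurable A -> measurable B ->
  {ae mu, forall x, A x -> B x} -> (mu A <= mu B)%E.
Proof.
move=> mA mB [N [mN N0 AN]].
apply: (@le_trans _ _ (mu (B `|` N))).
  apply: le_measure; rewrite ?inE//; first exact: measurableU.
  move=> x Ax; have [Bx|Bx] := pselect (B x); first by left.
  by right; apply: AN => /= /(_ Ax).
by rewrite measureU0.
Qed.

Lemma measurable_abs_gt f (s : R) : measurable_fun setT f ->
  measurable [set x | s < `|f x|].
Proof.
move=> mf.
rewrite (_ : [set x | _] = (fun x => `|f x|) @^-1` `]s, +oo[); last first.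
  by apply/seteqP; split=> x /=; rewrite in_itv/= andbT.
rewrite -[X in measurable X]setTI.
have mnf : measurable_fun setT (fun x => `|f x|).
  by apply: measurableT_comp => //; exact: measurable_normr.
exact: mnf.
Qed.

(** The rearrangement of an indicator is the indicator of [(0, m)]. *)
Lemma lorentz_norm_indic (p q : R) A (m : R) : 0 < p -> 0 < q ->
  measurable A -> mu A = m%:E ->
  lorentz_norm mu p q \1_A = (m `^ p^-1)%:E.
Proof.
move=> p0 q0 mA Am.
have m0 : 0 <= m by rewrite -lee_fin -Am measure_ge0.
have gt_indic (s : R) : 0 < s -> s < 1 -> [set x | (s < `|\1_A x|)%R] = A.
  move=> s0 s1; apply/seteqP; split => x /=; rewrite indicE;
    case: (boolP (x \in A)).
  - by rewrite inE.
  - by rewrite normr0 ltNge ltW.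
  - by rewrite normr1.
  - by rewrite notin_setE.
have gt_indic1 : [set x | (1 < `|\1_A x : R|)%R] = set0.
  apply/seteqP; split => x //=; rewrite indicE; case: (x \in A).
  - by rewrite normr1 ltxx.
  - by rewrite normr0 ltNge ler01.
have rearr t : 0 < t ->
    (rearrangement mu \1_A t `^ q = (\1_(`]0%R, m[) t)%:E)%E.
  move=> t0; rewrite indicE mem_setE in_itv/= t0/=; have [tm|mt] := ltP t m.
  - suff -> : rearrangement mu \1_A t = 1%E by rewrite poweR1r.
    apply/eqP; rewrite eq_le; apply/andP; split.
    + by apply: rearrangement_le => //; rewrite gt_indic1 measure0 lee_fin ltW.
    + by apply: rearrangement_ge => s s0 s1; rewrite gt_indic// Am lte_fin.
  - suff -> : rearrangement mu \1_A t = 0%E by rewrite poweR0r// gt_eqF.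
    (* levels s >= 1 are above the indicator, so s is cut down below 1 *)
    apply/eqP; rewrite eq_le rearrangement_ge0 andbT.
    apply/lee_addgt0Pr => s s0; rewrite add0e.
    apply: (@le_trans _ _ (Num.min s 2^-1)%:E); last first.
      by rewrite lee_fin ge_min lexx.
    apply: rearrangement_le; first by rewrite lt_min s0 invr_gt0 ltr0n.
    rewrite gt_indic ?Am ?lee_fin//; first by rewrite lt_min s0 invr_gt0 ltr0n.
    by rewrite gt_min invf_lt1 ?ltr1n ?orbT.
rewrite /lorentz_norm.
under eq_integral.
  by move=> t; rewrite inE/= in_itv/= andbT => /rearr ->; over.
rewrite integral_indic// setIidl; last by apply: subset_itvl; rewrite bnd_simp.
rewrite /= stieltjes_pow_itvoo ?divr_gt0// poweR_EFin -powRrM.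
by rewrite mulrAC divff ?gt_eqF// mul1r.
Qed.

End rearrangement.

(** * Two-sided estimate for functions constant on blocks *)

Section two_sided.
Context {R : realType} d (T : measurableType d).
Variable mu : {measure set T -> \bar R}.
Variables (A : nat -> set T) (b : nat -> R) (f : T -> R) (y : nat -> R).
Hypothesis mA : forall n, measurable (A n).
Hypothesis tA : trivIset setT A.
Hypothesis muA : forall n, mu (A n) = (b n - b n.+1)%:E.
Hypothesis b_cvg0 : b n @[n --> \oo] --> (0 : R).
Hypothesis mf : measurable_fun setT f.
Hypothesis fA : {ae mu, forall x, exists n, A n x /\ f x = y n}.

Let b_noninc : {homo b : m n / (m <= n)%N >-> n <= m}.
Proof.
apply/nonincreasing_seqP => n.
by rewrite -subr_ge0 -lee_fin -muA measure_ge0.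
Qed.

Let b_ge0 n : 0 <= b n.
Proof.
rewrite -(cvg_lim _ b_cvg0)//; apply: nonincreasing_cvgn_ge => //.
by apply/cvg_ex; exists 0.
Qed.

Lemma measure_tail n : mu (\bigcup_k A (n + k)%N) = (b n)%:E.
Proof.
rewrite measure_bigcup//; last first.
  by move=> i j _ _ /(tA I I) /addnI.
apply/cvg_lim => //.
apply: (@cvg_trans _ ((b n - b (n + k)%N)%:E @[k --> \oo])).
  apply: near_eq_cvg; near=> k.
  rewrite (eq_bigl xpredT); last by move=> i; rewrite in_setT.
  under eq_bigr do rewrite muA.
  rewrite sumEFin; congr EFin.
  under eq_bigr do rewrite -opprB -[(_ + _).+1]addnS.
  by rewrite sumrN (telescope_sumr (fun i => b (n + i)%N))// addn0 opprB.
apply/cvg_EFin; first by near=> k.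
rewrite -[X in _ --> X]subr0; apply: cvgB; first exact: cvg_cst.
under eq_fun do rewrite addnC.
by have := b_cvg0; rewrite -(cvg_shiftn n).
Unshelve. all: by end_near. Qed.

(** [A_n] lies in the superlevel set up to a null set. *)
Lemma distribution_ge n (s : R) : s < `|y n| ->
  ((b n - b n.+1)%:E <= mu [set x | (s < `|f x|)%R])%E.
Proof.
move=> sy; rewrite -muA; apply: le_measure_ae => //.
  exact: measurable_abs_gt.
apply: filterS fA => x [k [Akx fx]] Anx; rewrite /= fx.
suff -> : k = n by [].
by apply: (tA I I); exists x.
Qed.

(** Up to a null set, the superlevel set only meets the blocks [A_k] with
[k >= n], and those have total measure [b_n]. *)
Lemma distribution_le n (s : R) : (forall k, (k < n)%N -> `|y k| <= s) ->
  (mu [set x | (s < `|f x|)%R] <= (b n)%:E)%E.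
Proof.
move=> ys; rewrite -measure_tail; apply: le_measure_ae.
- exact: measurable_abs_gt.
- exact: bigcup_measurable.
apply: filterS fA => x [k [Akx fx]]; rewrite /= fx => syk.
have nk : (n <= k)%N by rewrite leqNgt; apply/negP => /ys; rewrite leNgt syk.
by exists (k - n)%N => //; rewrite subnKC.
Qed.

Local Notation h := (rearrangement mu f).

(** If [n] is the first index with [b_n <= t], then [f*(t)] is at most the
maximum of the [|y_k|] with [k < n]; replacing the maximum of the [|y_k|^q] by
their sum costs nothing in the final estimate. *)
Lemma rearrangement_powR_le (q t : R) : 0 < q -> 0 < t ->
  (h t `^ q <= \sum_(k <oo) (`|y k| `^ q)%:E * (\1_(`]0%R, b k]) t)%:E)%E.
Proof.
move=> q0 t0.
have [n bnt Hn] : exists2 n, b n <= t & forall k, (k < n)%N -> t < b k.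
  have exn : exists n, b n <= t.
    have : \forall n \near \oo, b n < t.
      by apply: (cvgr_lt 0); [exact: b_cvg0|].
    by case=> n _ /(_ n (leqnn n)) /ltW bnt; exists n.
  exists (ex_minn exn); case: ex_minnP => // m _ H k km.
  by rewrite ltNge; apply/negP => /H; rewrite leqNgt km.
pose S := \sum_(0 <= k < n) `|y k| `^ q.
have S0 : 0 <= S by apply: sumr_ge0 => *; exact: powR_ge0.
have yS k : (k < n)%N -> `|y k| <= S `^ q^-1.
  move=> kn; rewrite -[leLHS]powRr1// -[X in _ `^ X](@divff _ q) ?gt_eqF//.
  rewrite powRrM.
  apply: ge0_ler_powR; rewrite ?nnegrE ?powR_ge0 ?invr_ge0 ?(ltW q0)//.
  rewrite /S (bigD1_seq k) ?mem_index_iota ?iota_uniq//= lerDl.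
  by apply: sumr_ge0 => *; exact: powR_ge0.
(* S may vanish, but the levels of a rearrangement are positive: hence e *)
have hS : (h t <= (S `^ q^-1)%:E)%E.
  apply/lee_addgt0Pr => e e0; rewrite -EFinD; apply: rearrangement_le.
    by rewrite ltr_wpDl// powR_ge0.
  apply: (@le_trans _ _ (b n)%:E); last by rewrite lee_fin.
  by apply: distribution_le => k /yS /le_trans; apply; rewrite lerDl ltW.
apply: (@le_trans _ _ S%:E).
  rewrite -[S in leRHS]powRr1// -(@mulVf _ q) ?gt_eqF// powRrM -poweR_EFin.
  apply: gt0_ler_poweR; rewrite ?(ltW q0)//.
  - by rewrite in_itv/= rearrangement_ge0 leey.
  - by rewrite in_itv/= lee_fin powR_ge0 leey.
apply: le_trans (nneseries_lim_ge n _).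
  rewrite -sumEFin big_nat_cond [leRHS]big_nat_cond.
  apply: lee_sum => k /andP[/andP[_ kn] _].
  by rewrite indicE mem_set ?mule1//= in_itv/= t0 ltW// Hn.
by move=> k _ _; rewrite mule_ge0// lee_fin ?powR_ge0// indicE ler0n.
Qed.

(** The intervals [(K b_(k+1), K b_k]] are disjoint, so at most one term of the
series is nonzero, and on the [n]-th interval [t <= K b_n < m_n]. *)
Lemma rearrangement_powR_ge (K q t : R) : 0 < K -> 0 < q ->
  (forall n, K * b n < b n - b n.+1) ->
  (\sum_(k <oo) (`|y k| `^ q)%:E * (\1_(`]K * b k.+1, (K * b k)%R]) t)%:E
     <= h t `^ q)%E.
Proof.
move=> K0 q0 Kb.
have term0 k :
    (0 <= (`|y k| `^ q)%:E * (\1_(`]K * b k.+1, (K * b k)%R]) t)%:E)%E.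
  by rewrite mule_ge0// lee_fin ?powR_ge0// indicE ler0n.
have [[n tn]|nt] := pselect (exists n, `]K * b n.+1, K * b n]%classic t);
  last first.
  rewrite eseries0 ?poweR_ge0// => k _ _.
  by rewrite indicE memNset ?mule0// => tk; apply: nt; exists k.
rewrite (nneseriesD1 (n := n))// eseries0 ?adde0; last first.
  move=> k _ /= kn; rewrite indicE memNset ?mule0//= => tk.
  move: kn; rewrite neq_ltn => /orP[kn|kn].
  - move: tn tk; rewrite /= !in_itv/= => /andP[_ tn] /andP[tk _].
    have := lt_le_trans tk tn; rewrite ltr_pM2l// => /lt_geF/negP; apply.
    exact: b_noninc.
  - move: tn tk; rewrite /= !in_itv/= => /andP[tn _] /andP[_ tk].
    have := lt_le_trans tn tk; rewrite ltr_pM2l// => /lt_geF/negP; apply.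
    exact: b_noninc.
rewrite indicE mem_set// mule1 -poweR_EFin.
apply: gt0_ler_poweR; rewrite ?(ltW q0)//.
- by rewrite in_itv/= lee_fin normr_ge0 leey.
- by rewrite in_itv/= rearrangement_ge0 leey.
apply: rearrangement_ge => s s0 sy.
apply: lt_le_trans (distribution_ge sy); rewrite lte_fin.
by move: tn; rewrite /= in_itv/= => /andP[_ /le_lt_trans]; apply.
Qed.

Variables (p q r : R).
Hypotheses (p0 : 0 < p) (q0 : 0 < q) (b_gt0 : forall n, 0 < b n).
Hypotheses (r1 : r < 1) (br : forall n, b n.+1 <= r * b n).

Local Notation nu := (lebesgue_stieltjes_measure (cumul_pow (q / p))).
Local Notation a := (fun n => y n * (b n - b n.+1) `^ p^-1).

Let r_ge0 : 0 <= r.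
Proof. by rewrite -(pmulr_lge0 _ (b_gt0 0)) (le_trans _ (br 0)). Qed.

Let e0 : 0 < q / p. Proof. exact: divr_gt0. Qed.

Let gap_ge n : (1 - r) * b n <= b n - b n.+1.
Proof. by rewrite mulrBl mul1r lerB. Qed.

Let gap_ge0 n : 0 <= b n - b n.+1.
Proof. by apply: le_trans (gap_ge n); rewrite mulr_ge0 ?subr_ge0 ?(ltW r1). Qed.

Lemma ell_norm_weighted :
  'N[counting]_(q%:E)[EFin \o a]%E =
  ((\sum_(k <oo) (`|y k| `^ q * (b k - b k.+1) `^ (q / p))%:E) `^ q^-1)%E.
Proof.
rewrite Lnorm_counting//; congr (_ `^ _)%E; apply: eq_eseriesr => k _ /=.
rewrite normrM (ger0_norm (powR_ge0 _ _)) powRM ?powR_ge0//.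
by rewrite -powRrM [p^-1 * _]mulrC.
Qed.

(** The integrated upper bound has weights [b_k^e], and [b_k <= m_k / (1 - r)]. *)
Lemma lorentz_norm_le :
  (lorentz_norm mu p q f <=
     (((1 - r)^-1 `^ (q / p)) `^ q^-1)%:E * 'N[counting]_(q%:E)[EFin \o a])%E.
Proof.
rewrite ell_norm_weighted -poweR_EFin -poweRM; last 2 first.
- by rewrite lee_fin powR_ge0.
- by apply: nneseries_ge0 => k _ _; rewrite lee_fin mulr_ge0 ?powR_ge0.
rewrite /lorentz_norm; apply: gt0_ler_poweR; rewrite ?invr_ge0 ?(ltW q0)//.
- by rewrite in_itv/= leey andbT integral_ge0// => t _; exact: poweR_ge0.
- rewrite in_itv/= leey andbT mule_ge0// ?lee_fin ?powR_ge0//.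
  by apply: nneseries_ge0 => k _ _; rewrite lee_fin mulr_ge0 ?powR_ge0.
apply: (@le_trans _ _ (\int[nu]_(t in `]0%R, +oo[)
  (\sum_(k <oo) (`|y k| `^ q)%:E * (\1_(`]0%R, b k]) t)%:E))%E).
  apply: ge0_le_integral_nonmeasurable => t; rewrite /= in_itv/= andbT => t0.
    exact: poweR_ge0.
  exact: rearrangement_powR_le.
rewrite (@integral_sum_indic _ _ (fun k => `|y k| `^ q) (fun=> 0) b)//.
rewrite -nneseriesZl; last by move=> k _; rewrite lee_fin mulr_ge0 ?powR_ge0.
apply: lee_nneseries => [k _ _|k _].
  by rewrite lee_fin mulr_ge0 ?powR_ge0// powR0 ?gt_eqF// subr0 powR_ge0.
rewrite -EFinM lee_fin mulrCA ler_wpM2l ?powR_ge0//.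
rewrite powR0 ?gt_eqF// subr0 -powRM ?(gap_ge0 k)//; last first.
  by rewrite invr_ge0 subr_ge0 (ltW r1).
apply: ge0_ler_powR; rewrite ?nnegrE ?(ltW e0)//.
- by rewrite mulr_ge0 ?(gap_ge0 k)// invr_ge0 subr_ge0 (ltW r1).
- by rewrite mulrC ler_pdivlMr ?subr_gt0// mulrC.
Qed.

(** The increments satisfy
[(K b_k)^e - (K b_(k+1))^e >= K^e (1 - r^e) b_k^e], and [b_k >= m_k]. *)
Lemma lorentz_norm_ge :
  (((((1 - r) / 2) `^ (q / p) * (1 - r `^ (q / p))) `^ q^-1)%:E *
     'N[counting]_(q%:E)[EFin \o a] <= lorentz_norm mu p q f)%E.
Proof.
have K0 : 0 < (1 - r) / 2 by rewrite divr_gt0// subr_gt0.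
have re : r `^ (q / p) <= 1 by rewrite ltW// powR_lt1.
set c := (_ * (1 - _)).
have c0 : 0 <= c by rewrite mulr_ge0 ?powR_ge0 ?subr_ge0.
rewrite ell_norm_weighted -poweR_EFin -poweRM; last 2 first.
- by rewrite lee_fin.
- by apply: nneseries_ge0 => k _ _; rewrite lee_fin mulr_ge0 ?powR_ge0.
rewrite /lorentz_norm; apply: gt0_ler_poweR; rewrite ?invr_ge0 ?(ltW q0)//.
- rewrite in_itv/= leey andbT mule_ge0// ?lee_fin ?powR_ge0//.
  by apply: nneseries_ge0 => k _ _; rewrite lee_fin mulr_ge0 ?powR_ge0.
- by rewrite in_itv/= leey andbT integral_ge0// => t _; exact: poweR_ge0.
(* halving makes K * b k smaller than the k-th gap even at the closed end *)
set K := (1 - r) / 2 in K0 *.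
apply: (@le_trans _ _ (\int[nu]_(t in `]0%R, +oo[)
  (\sum_(k <oo) (`|y k| `^ q)%:E *
     (\1_(`]K * b k.+1, (K * b k)%R]) t)%:E))%E); last first.
  apply: ge0_le_integral_nonmeasurable => t; rewrite /= in_itv/= andbT => t0.
    apply: nneseries_ge0 => k _ _.
    by rewrite mule_ge0// lee_fin ?powR_ge0// indicE ler0n.
  apply: rearrangement_powR_ge => // n; apply: lt_le_trans (gap_ge n).
  by rewrite ltr_pM2r// ltr_pdivrMr// ltr_pMr ?ltr1n// subr_gt0.
rewrite (@integral_sum_indic _ _ (fun k => `|y k| `^ q)
  (fun k => K * b k.+1) (fun k => K * b k))//; last 2 first.
- by move=> k; rewrite mulr_ge0 ?(ltW K0).
- by move=> k; rewrite ler_pM2l// b_noninc.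
rewrite -nneseriesZl; last by move=> k _; rewrite lee_fin mulr_ge0 ?powR_ge0.
apply: lee_nneseries => [k _ _|k _].
  by rewrite -EFinM lee_fin mulr_ge0// mulr_ge0 ?powR_ge0.
rewrite -EFinM lee_fin mulrCA ler_wpM2l ?powR_ge0//.
rewrite (powRM _ (ltW K0) (b_ge0 k)) (powRM _ (ltW K0) (b_ge0 k.+1)) -mulrBr.
rewrite /c -mulrA ler_wpM2l ?powR_ge0//.
apply: (@le_trans _ _ ((1 - r `^ (q / p)) * b k `^ (q / p))).
  rewrite ler_wpM2l ?subr_ge0//.
  apply: ge0_ler_powR; rewrite ?nnegrE ?(ltW e0)//.
  by rewrite gerBl.
rewrite mulrBl mul1r lerB// -powRM//.
by apply: ge0_ler_powR; rewrite ?nnegrE ?(ltW e0)// mulr_ge0.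
Qed.

End two_sided.

(** The constants depend on [p], [q] and [r] alone, so one pair serves all
functions on all measure spaces. *)
Lemma lorentz_norm_equiv_ell (R : realType) (b : nat -> R) (p q r : R) :
  b n @[n --> \oo] --> (0 : R) -> 0 < p -> 0 < q -> (forall n, 0 < b n) ->
  r < 1 -> (forall n, b n.+1 <= r * b n) ->
  exists c C : R, [/\ 0 < c, c <= C &
    forall d (T : measurableType d) (mu : {measure set T -> \bar R})
      (A : nat -> set T) (f : T -> R) (y : nat -> R),
    (forall n, measurable (A n)) -> trivIset setT A ->
    (forall n, mu (A n) = (b n - b n.+1)%:E) -> measurable_fun setT f ->
    {ae mu, forall x, exists n, A n x /\ f x = y n} ->
    let N := 'N[counting]_(q%:E)[EFin \o
               (fun n => y n * (b n - b n.+1) `^ p^-1)%R]%E in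
    (c%:E * N <= lorentz_norm mu p q f <= C%:E * N)%E].
Proof.
move=> b_cvg0 p0 q0 b_gt0 r1 br.
have r_ge0 : 0 <= r.
  by rewrite -(pmulr_lge0 _ (b_gt0 0%N)) (le_trans _ (br 0%N))// ltW.
set c := (((1 - r) / 2) `^ (q / p) * (1 - r `^ (q / p))) `^ q^-1.
set C := ((1 - r)^-1 `^ (q / p)) `^ q^-1.
have c0 : 0 < c.
  rewrite powR_gt0// mulr_gt0 ?powR_gt0 ?divr_gt0 ?subr_gt0//.
  by rewrite powR_lt1// divr_gt0.
exists c, (Num.max c C); split => //; first by rewrite le_max lexx.
move=> d T mu A f y mA tA muA mf fA; cbv zeta; apply/andP; split.
  exact: (lorentz_norm_ge mA tA muA b_cvg0 mf fA p0 q0 b_gt0 r1 br).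
apply: le_trans (lorentz_norm_le mA tA muA b_cvg0 mf fA p0 q0 r1 br) _.
by apply: lee_wpmul2r; [exact: Lnorm_ge0|rewrite lee_fin le_max lexx orbT].
Qed.

(** * Functions on atoms *)

Section atomic.
Context {R : realType} d (T : measurableType d).
Variable mu : {measure set T -> \bar R}.

(** For each rational [s], one of the two parts of the atom where [f < s] and
where [f >= s] is null. Outside the countable union of these null parts no
rational separates two values of [f]. *)
Lemma atom_ae_cst (A : set T) (f : T -> R) : is_atom mu A ->
  measurable_fun setT f -> exists y, {ae mu, forall x, A x -> f x = y}.
Proof.
move=> [mA A0 atomA] mf.
pose D (s : rat) : set T := A `&` [set x | f x < ratr s].
have mD s : measurable (D s).
  apply: measurableI => //.
  rewrite (_ : [set x | _] = setT `&` f @^-1` `]-oo, ratr s[); first exact: mf.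
  by apply/seteqP; split=> x; rewrite /= in_itv/= => // -[].
pose E s := if pselect (mu (D s) = 0) then D s else A `\` D s.
have E0 s : mu.-negligible (E s).
  rewrite /E; case: pselect => [D0|D0]; first exact/negligibleP.
  apply/negligibleP; first exact: measurableD.
  by have [] := atomA _ (mD s) (@subIsetl _ _ _).
pose N := \bigcup_n E (odflt 0 (unpickle n)).
have EN s : E s `<=` N.
  by move=> x Ex; exists (pickle s) => //=; rewrite pickleK.
have N0 : mu.-negligible N by exact: negligible_bigcup.
have [x0 [Ax0 Nx0]] : A `\` N !=set0.
  apply/set0P/eqP => AN.
  have : mu A = 0.
    apply/negligibleP => //; apply: negligibleS N0 => x Ax.
    by apply: contrapT => Nx; have : (A `\` N) x by []; rewrite AN.
  by move=> A00; rewrite A00 ltxx in A0.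
have sep s u v : A u -> A v -> f u < ratr s -> ratr s < f v -> N u \/ N v.
  move=> Au Av us sv; have Dv : ~ D s v by move=> [_ /=]; rewrite ltNge ltW.
  have := EN s; rewrite /E; case: pselect => [?|?] EsN.
  - by left; apply: EsN.
  - by right; apply: EsN.
exists (f x0); apply: negligibleS N0 => x /not_implyP[Ax /eqP].
rewrite neq_lt => /orP[fx|fx]; have [s] := rat_in_itvoo fx;
  rewrite in_itv/= => /andP[s1 s2].
- by have [|/Nx0] := sep s x x0 Ax Ax0 s1 s2.
- by have [/Nx0|] := sep s x0 x Ax0 Ax s1 s2.
Qed.

Lemma ae_cst_unique (A : set T) (f : T -> R) (y z : R) :
  measurable A -> (0 < mu A)%E ->
  {ae mu, forall x, A x -> f x = y} -> {ae mu, forall x, A x -> f x = z} ->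
  y = z.
Proof.
move=> mA A0 fy fz; apply: contrapT => yz; have : (mu A <= mu set0)%E.
  apply: le_measure_ae => //; apply: filterS2 fy fz => x fy fz Ax.
  by apply: yz; rewrite -(fy Ax) fz.
by rewrite measure0 leNgt A0.
Qed.

(** This builds preimages under the isomorphism with [ell_q]. *)
Lemma measurable_glue (A : nat -> set T) (y : nat -> R) :
  (forall n, measurable (A n)) -> trivIset setT A ->
  exists2 f : T -> R, measurable_fun setT f & forall n x, A n x -> f x = y n.
Proof.
move=> mA tA.
pose f x := if pselect (exists n, A n x) is left e then y (sval (cid e)) else 0.
have fA n x : A n x -> f x = y n.
  move=> Anx; rewrite /f; case: pselect => [e|[]]; last by exists n.
  by congr y; apply: (tA _ _ I I); exists x; split=> //; exact: svalP (cid e).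
have f0 x : ~ (\bigcup_n A n) x -> f x = 0.
  by move=> nA; rewrite /f; case: pselect => // -[n Anx]; case: nA; exists n.
exists f => // _ Y mY; rewrite setTI.
rewrite (_ : f @^-1` Y =
    (\bigcup_(n in [set n | Y (y n)]) A n) `|`
    (if pselect (Y 0) then ~` \bigcup_n A n else set0)).
  apply: measurableU; first exact: bigcup_measurable.
  case: pselect => [?|?] /=; last exact: measurable0.
  by apply: measurableC; exact: bigcup_measurable.
apply/seteqP; split=> x.
- rewrite /=; have [[n _ Anx]|nA] := pselect ((\bigcup_n A n) x).
    by rewrite (fA _ _ Anx) => Yy; left; exists n.
  by rewrite (f0 _ nA) => Y0; right; case: pselect.
- move=> [[n /= Yy Anx]|]; first by rewrite /= (fA _ _ Anx).
  by case: pselect => [Y0 nA|//]; rewrite /= f0.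
Qed.

End atomic.

(** * Real sequences and finitely supported vectors of ell_q *)

Section sequences.
Context {R : realType}.
Implicit Types (b : nat -> R).

Lemma sup_range_lt (u : nat -> R) (M l : R) : (forall n, u n <= M) ->
  sup (range u) < l -> exists2 r, r < l & forall n, u n <= r.
Proof.
move=> uM supl; exists (sup (range u)) => // n.
by apply: ub_le_sup; [exists M => _ [k _ <-]|exists n].
Qed.

(** By hypothesis [b_(n+1) - r b_n] is nondecreasing in [n]; it tends to 0. *)
Lemma ratio_gap_ratio b (r : R) : b n @[n --> \oo] --> (0 : R) ->
  (forall n, b n.+1 - b n.+2 <= r * (b n - b n.+1)) ->
  forall n, b n.+1 <= r * b n.
Proof.
move=> b0 gap n.
pose u n := b n.+1 - r * b n.
have u_cvg : u k @[k --> \oo] --> (0 : R).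
  rewrite -[X in _ --> X](subr0 0) -{2}(mulr0 r).
  apply: cvgB; last by apply: cvgM => //; exact: cvg_cst.
  by have := b0; rewrite -(cvg_shiftS b).
rewrite -subr_le0 -(cvg_lim _ u_cvg)//; apply: nondecreasing_cvgn_le.
  apply/nondecreasing_seqP => k; rewrite /u -subr_ge0.
  have := gap k; rewrite -subr_ge0; congr (0 <= _).
  rewrite mulrBr !opprB addrACA [RHS]addrC [RHS]addrACA; congr (_ + _).
  by rewrite addrC.
by apply/cvg_ex; exists 0.
Qed.

Lemma trivIset_itvoc b : (forall n, b n.+1 <= b n) ->
  trivIset setT (fun n => `]b n.+1, b n]%classic).
Proof.
move=> bS; have bn : {homo b : m n / (m <= n)%N >-> n <= m}.
  exact/nonincreasing_seqP.
have lt i j t : (i < j)%N ->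
    `]b i.+1, b i]%classic t -> ~ `]b j.+1, b j]%classic t.
  move=> ij; rewrite /= !in_itv/= => /andP[bt _] /andP[_ tb].
  by have := lt_le_trans bt (le_trans tb (bn _ _ ij)); rewrite ltxx.
apply/trivIsetP => i j _ _ ij; apply/seteqP; split=> t //= -[ti tj].
by move: ij; rewrite neq_ltn => /orP[/lt /(_ ti tj)|/lt /(_ tj ti)].
Qed.

Lemma itvoc_cover b (t : R) : b n @[n --> \oo] --> (0 : R) ->
  0 < t <= b 0%N -> exists n, `]b n.+1, b n]%classic t.
Proof.
move=> b0 /andP[t0 tb].
have ex : exists n, b n < t.
  have : \forall n \near \oo, b n < t by apply: (cvgr_lt 0).
  by case=> n _ /(_ n (leqnn n)); exists n.
case: (ex_minnP ex) => -[|n] bt Hn; first by rewrite ltNge tb in bt.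
exists n; rewrite /= in_itv/= bt leNgt; apply/negP => /Hn.
by rewrite ltnn.
Qed.

Lemma powR_small (s e : R) : 0 < s -> 0 < e ->
  exists2 eta, 0 < eta & forall t, 0 <= t -> t < eta -> t `^ s < e.
Proof.
move=> s0 e0; exists (e `^ s^-1); first exact: powR_gt0.
move=> t t0 /(gt0_ltr_powR s0); rewrite !nnegrE => /(_ t0 (powR_ge0 _ _)).
by rewrite -powRrM mulVf ?gt_eqF// powRr1// ltW.
Qed.

End sequences.

Section ell.
Context {R : realType} (q : R).

Lemma ell_unit_sumE (a : nat -> R) n :
  (\sum_(i < n) a i *: ell_unit q i) =
  (fun k => if (k < n)%N then a k else 0) :> (nat -> R).
Proof.
apply/funext => k; rewrite fct_sumE.
have entry i : (a i *: ell_unit q i) k = a i * (k == i)%:R by [].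
under eq_bigr do rewrite entry.
case: ltnP => [kn|nk].
  rewrite (bigD1 (Ordinal kn))//= big1 ?addr0 ?eqxx ?mulr1// => i /eqP ik.
  by case: eqP => [ki|]; [case: ik; exact/val_inj|rewrite mulr0].
by rewrite big1// => i _; rewrite gtn_eqF ?mulr0// (leq_trans _ nk).
Qed.

Lemma ell_norm_sum (a : nat -> R) n : 0 < q ->
  qnorm (\sum_(i < n) a i *: ell_unit q i) =
  ((\sum_(0 <= i < n) `|a i| `^ q) `^ q^-1)%:E.
Proof.
move=> q0; rewrite /= ell_unit_sumE Lnorm_counting// -poweR_EFin.
congr (_ `^ _)%E.
rewrite (nneseries_split 0 n); last by move=> k _; rewrite poweR_ge0.
rewrite add0n [X in (_ + X)%E]eseries0 ?adde0; last first.
  by move=> k nk _ /=; rewrite ltnNge nk/= normr0 powR0// gt_eqF.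
rewrite -sumEFin; apply: eq_big_nat => k /andP[_ kn] /=.
by rewrite kn.
Qed.

End ell.

(** * Blocks of the unit interval *)

Section unit_interval.
Context {R : realType}.

(** The domain is the alias of [R] on which [lebesgue_measure] lives; spelling
it out makes norms in [lorentz01] instances of the general results by
conversion. *)
Definition lebesgue01 : {measure set (measurableTypeR R) -> \bar R} :=
  mrestr (@lebesgue_measure R) (measurable_itv `]0%R, 1%R[).

Local Notation mu01 := lebesgue01.

(** The point [v] matters when [v = 1], which is outside the open interval; the
bound from below is taken on [(u, v)]. *)
Lemma lebesgue01_itvoc (u v : R) : 0 <= u -> u <= v -> v <= 1 ->
  mu01 `]u, v]%classic = (v - u)%:E.
Proof.
move=> u0 uv v1; rewrite /= /mrestr; apply/eqP; rewrite eq_le.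
apply/andP; split.
  apply: (@le_trans _ _ (@lebesgue_measure R `]u, v])).
    by apply: le_measure; rewrite ?inE//; exact: measurableI.
  rewrite lebesgue_measure_itv/= lte_fin; case: ltP => // _.
  by rewrite lee_fin subr_ge0.
apply: (@le_trans _ _ (@lebesgue_measure R `]u, v[)).
  rewrite lebesgue_measure_itv/= lte_fin; case: ltP => // vu.
  by rewrite lee_fin subr_le0.
apply: le_measure; rewrite ?inE//; first exact: measurableI.
move=> t; rewrite /= !in_itv/= => /andP[ut tv]; rewrite ut (ltW tv).
by rewrite (le_lt_trans u0 ut) (lt_le_trans tv v1).
Qed.

Lemma ae_lebesgue01 (P : R -> Prop) : (forall t, 0 < t < 1 -> P t) ->
  {ae mu01, forall t, P t}.
Proof.
move=> P01; exists (~` `]0, 1[%classic); split.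
- exact: measurableC.
- by rewrite /= /mrestr setICl measure0.
- by apply: subsetC => t /=; rewrite in_itv/=; exact: P01.
Qed.

Variables (p q : R) (b : nat -> R).
Hypotheses (b0 : b 0%N = 1) (b_decr : forall n, b n.+1 < b n)
  (b_gt0 : forall n, 0 < b n) (b_cvg0 : b n @[n --> \oo] --> (0 : R)).

Local Notation A := (fun n => `]b n.+1, b n]%classic).
Local Notation B := (fun n => (b n - b n.+1) `^ p^-1).
Local Notation x := (fun n : nat => (B n)^-1 *: (\1_(A n) : lorentz01 p q)).

Let b_noninc : {homo b : m n / (m <= n)%N >-> n <= m}.
Proof. by apply/nonincreasing_seqP => n; exact: ltW. Qed.

Let b_le1 n : b n <= 1. Proof. by rewrite -b0 b_noninc. Qed.

Let tA : trivIset setT A.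
Proof. by apply: trivIset_itvoc => n; exact: ltW. Qed.

Let B_gt0 n : 0 < B n. Proof. by rewrite powR_gt0// subr_gt0. Qed.

Lemma lebesgue01_blocks m n : (m <= n)%N ->
  mu01 `]b n, b m]%classic = (b m - b n)%:E.
Proof. by move=> mn; rewrite lebesgue01_itvoc ?(ltW (b_gt0 n))// b_noninc. Qed.

Lemma sum_blocksE (a : nat -> R) n (t : R) :
  (\sum_(i < n) a i *: x i) t = \sum_(i < n) a i * ((B i)^-1 * \1_(A i) t).
Proof. by rewrite fct_sumE. Qed.

Lemma sum_blocks_val (a : nat -> R) n k (t : R) : A k t ->
  (\sum_(i < n) a i *: x i) t = (if (k < n)%N then a k else 0) / B k.
Proof.
move=> Akt; rewrite sum_blocksE.
have off i : i != k -> \1_(A i) t = 0 :> R.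
  move=> ik; rewrite indicE memNset// => Ait.
  by move/eqP: ik; apply; apply: (tA I I); exists t.
case: ltnP => [kn|nk].
  rewrite (bigD1 (Ordinal kn))//= big1 ?addr0.
    by rewrite indicE mem_set// mulr1.
  by move=> i ik; rewrite off ?mulr0.
rewrite big1 ?mul0r// => i _; rewrite off ?mulr0// ltn_eqF//.
exact: leq_trans nk.
Qed.

Lemma measurable_sum_blocks (a : nat -> R) n :
  measurable_fun setT (\sum_(i < n) a i *: x i : R -> R).
Proof.
apply: (eq_measurable_fun
  (fun t => \sum_(i < n) a i * ((B i)^-1 * \1_(A i) t))).
  by move=> t _; rewrite sum_blocksE.
apply: measurable_sum => i; apply: measurable_funM => //.
by apply: measurable_funM => //; exact: measurable_indic.
Qed.

Hypotheses (p0 : 0 < p) (q0 : 0 < q).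

Lemma lorentz01_norm_block m n : (m <= n)%N ->
  qnorm (\1_(`]b n, b m]) : lorentz01 p q) = ((b m - b n) `^ p^-1)%:E.
Proof.
move=> mn; apply: (@lorentz_norm_indic R _ (measurableTypeR R) mu01) => //.
exact: lebesgue01_blocks.
Qed.

Lemma blocks_equivalent_ell (r : R) : r < 1 -> (forall n, b n.+1 <= r * b n) ->
  equivalent_seq x (@ell_unit R q).
Proof.
move=> r1 br.
have [c [C [c0 cC bounds]]] := lorentz_norm_equiv_ell b_cvg0 p0 q0 b_gt0 r1 br.
exists c, C; split => // n a.
pose f : R -> R := \sum_(i < n) a i *: x i.
pose y k := (if (k < n)%N then a k else 0) / B k.
have fA : {ae mu01, forall t, exists k, A k t /\ f t = y k}.
  apply: ae_lebesgue01 => t /andP[t0 t1].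
  have [|k Akt] := itvoc_cover (t := t) b_cvg0; first by rewrite t0 b0 ltW.
  by exists k; split => //; exact: sum_blocks_val.
have mA k : measurable (A k : set (measurableTypeR R)) by exact: measurable_itv.
have muA k : mu01 (A k) = (b k - b k.+1)%:E by rewrite lebesgue01_blocks.
have mf : measurable_fun setT (f : measurableTypeR R -> R).
  exact: measurable_sum_blocks.
have -> : qnorm (\sum_(i < n) a i *: ell_unit q i) =
    'N[counting]_(q%:E)[EFin \o (fun k => y k * (b k - b k.+1) `^ p^-1)%R]%E.
  rewrite /= ell_unit_sumE; congr (Lnorm _ _ (EFin \o _)); apply/funext => k.
  by rewrite /y mulfVK// gt_eqF.
exact: (bounds _ _ _ _ _ _ mA tA muA mf fA).
Qed.

Lemma sum_blocks_indic m k :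
  (\sum_(i < m + k) (if (m <= i)%N then B i else 0) *: x i : R -> R) =
  \1_(`]b (m + k)%N, b m]).
Proof.
apply/funext => t.
rewrite [LHS](sum_blocksE (fun i => if (m <= i)%N then B i else 0)).
elim: k => [|k IH].
  rewrite addn0 set_itvoc0// indic0 big1// => i _.
  by rewrite leqNgt ltn_ord/= mul0r.
rewrite addnS big_ord_recr/= IH leq_addr mulrA divff ?gt_eqF// mul1r !indicE.
have bS := b_decr (m + k); have bm := b_noninc (leq_addr k m).
rewrite !mem_setE !in_itv/=.
have [t1|t1] := ltP (b (m + k)%N) t.
  by rewrite (lt_trans bS t1) addr0.
by rewrite (le_trans t1 bm) andbT add0r.
Qed.

(** Sums of consecutive blocks are tested. With [s = |e - 1|] and [t = m / S],
the bound [m_i <= m] turns equivalence into [c^q <= t^s] if [e < 1] and into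
[C^(-q) <= t^s] if [e > 1], while [t] can be made arbitrarily small. *)
Lemma blocks_not_equivalent_ell : p <> q ->
  (forall n, b n.+1 - b n.+2 <= b n - b n.+1) ->
  b n.+1 / b n @[n --> \oo] --> (1 : R) ->
  ~ equivalent_seq x (@ell_unit R q).
Proof.
move=> pq gap ratio [c [C [c0 cC H]]].
have C0 : 0 < C by exact: lt_le_trans cC.
pose e := q / p.
have e0 : 0 < e by exact: divr_gt0.
have e1 : e != 1.
  apply/eqP => /(congr1 ( *%R^~ p)).
  by rewrite mulfVK ?gt_eqF// mul1r => /esym.
pose dl := Num.min (c `^ q) ((C `^ q)^-1).
have dl0 : 0 < dl by rewrite lt_min invr_gt0 !powR_gt0.
have s0 : 0 < `|e - 1| by rewrite normr_gt0 subr_eq0.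
have [eta eta0 small] := powR_small s0 dl0.
(* n makes m / b n < eta / 2, and k makes S >= b n / 2: hence m / S < eta *)
have [n n_eta] : exists n, (b n - b n.+1) / b n < eta / 2.
  have : \forall n \near \oo, 1 - eta / 2 < b n.+1 / b n.
    by apply: (cvgr_gt 1) => //; rewrite ltrBlDr ltrDl divr_gt0.
  case=> n _ /(_ n (leqnn n)) /= Hn; exists n.
  by rewrite mulrBl divff ?gt_eqF// ltrBlDr -ltrBlDl.
have [k nk] : exists k, b (n + k)%N <= b n / 2.
  have : \forall k \near \oo, b k < b n / 2.
    by apply: (cvgr_lt 0) => //; rewrite divr_gt0.
  case=> N _ /(_ (n + N)%N (leq_addl _ _)) /ltW HN; by exists N.
set m := b n - b n.+1 in n_eta.
have m0 : 0 < m by rewrite subr_gt0.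
pose S := b n - b (n + k)%N.
have S2 : b n / 2 <= S.
  by rewrite lerBrDl -lerBrDr [X in X - _](splitr (b n)) addrK.
have S0 : 0 < S by apply: lt_le_trans S2; rewrite divr_gt0.
have t_small : (m / S) `^ `|e - 1| < dl.
  apply: small; first by rewrite divr_ge0 ?ltW.
  rewrite ltr_pdivrMr//; apply: lt_le_trans (_ : eta * (b n / 2) <= _).
    by move: n_eta; rewrite ltr_pdivrMr// mulrAC mulrA.
  by rewrite ler_pM2l.
pose W := \sum_(n <= i < n + k) (b i - b i.+1) `^ e.
have W0 : 0 <= W by apply: sumr_ge0 => *; exact: powR_ge0.
have gap_le i : (n <= i)%N -> b i - b i.+1 <= m.
  by have /nonincreasing_seqP := gap; apply.
have SE : S = \sum_(n <= i < n + k) (b i - b i.+1).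
  rewrite -[S]opprB -telescope_sumr ?leq_addr// -sumrN.
  by apply: eq_bigr => i _; rewrite opprB.
pose w i := if (n <= i)%N then B i else 0.
have norm_block : qnorm (\sum_(i < n + k) w i *: x i) = (S `^ p^-1)%:E.
  rewrite -[LHS]/(lorentz_norm mu01 p q (\sum_(i < n + k) w i *: x i : R -> R)).
  rewrite [X in lorentz_norm _ _ _ X]sum_blocks_indic.
  exact: lorentz01_norm_block (leq_addr k n).
have norm_w : qnorm (\sum_(i < n + k) w i *: ell_unit q i) = (W `^ q^-1)%:E.
  rewrite (ell_norm_sum w (n + k) q0).
  suff -> : \sum_(0 <= i < n + k) `|w i| `^ q = W by [].
  rewrite (@big_cat_nat _ _ _ n)//= ?leq_addr// big_nat big1 ?add0r; last first.
    by move=> i /andP[_ i_n]; rewrite /w leqNgt i_n normr0 powR0// gt_eqF.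
  apply: eq_big_nat => i /andP[ni _].
  by rewrite /w ni ger0_norm ?powR_ge0// -powRrM [p^-1 * q]mulrC.
have := H (n + k)%N w; rewrite norm_w norm_block.
rewrite -!EFinM !lee_fin => /andP[lo up].
have raise u v : 0 <= u -> u <= v -> u `^ q <= v `^ q.
  move=> u0 uv; apply: ge0_ler_powR; rewrite ?nnegrE ?(ltW q0)//.
  exact: le_trans uv.
have root : (W `^ q^-1) `^ q = W by rewrite -powRrM mulVf ?gt_eqF// powRr1.
have Se : (S `^ p^-1) `^ q = S `^ e by rewrite -powRrM [p^-1 * q]mulrC.
have {}lo : c `^ q * W <= S `^ e.
  rewrite -Se -[in leLHS]root -powRM ?powR_ge0 ?(ltW c0)//.
  by apply: raise lo; rewrite mulr_ge0 ?powR_ge0 ?(ltW c0).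
have {}up : S `^ e <= C `^ q * W.
  rewrite -Se -[in leRHS]root -powRM ?powR_ge0 ?(ltW C0)//.
  by apply: raise up; rewrite powR_ge0.
set s := `|e - 1| in s0 t_small small.
set t := m / S in t_small.
have t0 : 0 <= t by rewrite divr_ge0// ltW.
have mE : m `^ s = t `^ s * S `^ s by rewrite -powRM ?(ltW S0)// divfK ?gt_eqF.
have gap0 i : 0 < b i - b i.+1 by rewrite subr_gt0.
have split_pow u r1 r2 : 0 < u -> u `^ (r1 + r2) = u `^ r1 * u `^ r2.
  by move=> u0; apply: powRD; rewrite (gt_eqF u0) implybT.
have [e_lt1|e_ge1] := ltP e 1.
- have es1 u : 0 < u -> u `^ e * u `^ s = u.
    move=> u0; rewrite -split_pow// /s ltr0_norm ?subr_lt0//.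
    by rewrite opprB addrC subrK powRr1// ltW.
  have WS : S <= W * m `^ s.
    rewrite SE /W mulr_suml big_nat_cond [leRHS]big_nat_cond.
    apply: ler_sum => i /andP[/andP[ni _] _].
    rewrite -[leLHS]es1// ler_wpM2l ?powR_ge0//.
    by apply: ge0_ler_powR;
      rewrite ?nnegrE ?(ltW s0) ?(ltW m0) ?(ltW (gap0 i)) ?gap_le.
  have : c `^ q * S <= t `^ s * S.
    apply: (@le_trans _ _ (c `^ q * (W * m `^ s))).
      by rewrite ler_wpM2l ?powR_ge0.
    rewrite mulrA (le_trans (ler_wpM2r (powR_ge0 _ _) lo))// mE mulrCA.
    by rewrite es1.
  rewrite ler_pM2r// leNgt => /negP; apply.
  by apply: lt_le_trans t_small _; rewrite ge_min lexx.
- have es1 u : 0 < u -> u `^ e = u * u `^ s.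
    move=> u0; rewrite -{2}(powRr1 (ltW u0)) -split_pow//.
    by rewrite /s ger0_norm ?subr_ge0// addrC subrK.
  have WS : W <= S * m `^ s.
    rewrite SE /W mulr_suml big_nat_cond [leRHS]big_nat_cond.
    apply: ler_sum => i /andP[/andP[ni _] _].
    rewrite es1// ler_wpM2l ?(ltW (gap0 i))//.
    by apply: ge0_ler_powR;
      rewrite ?nnegrE ?(ltW s0) ?(ltW m0) ?(ltW (gap0 i)) ?gap_le.
  have Ss0 : 0 < S * S `^ s by rewrite mulr_gt0// powR_gt0.
  have : 1 * (S * S `^ s) <= C `^ q * t `^ s * (S * S `^ s).
    rewrite mul1r -es1// (le_trans up)//.
    rewrite (le_trans (ler_wpM2l (powR_ge0 _ _) WS))// mE es1//.
    by rewrite [S * (_ * _)]mulrCA !mulrA.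
  rewrite ler_pM2r// leNgt => /negP; apply.
  rewrite mulrC -ltr_pdivlMr ?powR_gt0// mul1r.
  by apply: lt_le_trans t_small _; rewrite ge_min lexx orbT.
Qed.

End unit_interval.

(** * Purely atomic spaces *)

Section atomic_lorentz.
Context {R : realType} d (T : measurableType d).
Variable mu : {measure set T -> \bar R}.
Variables (A : nat -> set T) (b : nat -> R) (p q r : R).
Hypothesis atomicA : purely_atomic mu A.
Hypothesis muA : forall n, mu (A n) = (b n - b n.+1)%:E.
Hypotheses (b_decr : forall n, b n.+1 < b n) (b_gt0 : forall n, 0 < b n)
  (b_cvg0 : b n @[n --> \oo] --> (0 : R)).
Hypotheses (p0 : 0 < p) (q0 : 0 < q).
Hypotheses (r1 : r < 1) (br : forall n, b n.+1 <= r * b n).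

Let atomA n : is_atom mu (A n). Proof. by case: atomicA. Qed.
Let mA n : measurable (A n). Proof. by case: (atomA n). Qed.
Let A_gt0 n : (0 < mu (A n))%E. Proof. by case: (atomA n). Qed.
Let tA : trivIset setT A. Proof. by case: atomicA. Qed.

Let A_cover : {ae mu, forall x, exists n, A n x}.
Proof.
exists (~` \bigcup_n A n); split.
- by apply: measurableC; exact: bigcup_measurable.
- by case: atomicA.
- by apply: subsetC => x [n _ Anx]; exists n.
Qed.

Let w n := (b n - b n.+1) `^ p^-1.
Let w_neq0 n : w n != 0. Proof. by rewrite gt_eqF// powR_gt0// subr_gt0. Qed.

Definition atom_value (f : T -> R) n : R :=
  xget 0 [set y | {ae mu, forall x, A n x -> f x = y}].

Lemma atom_valueP f n : measurable_fun setT f ->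
  {ae mu, forall x, A n x -> f x = atom_value f n}.
Proof.
move=> mf; rewrite /atom_value; case: xgetP => [y -> //|nof].
by have [y fy] := atom_ae_cst (atomA n) mf; case: (nof y).
Qed.

Lemma atom_value_eq f n y : measurable_fun setT f ->
  {ae mu, forall x, A n x -> f x = y} -> atom_value f n = y.
Proof.
by move=> mf; apply: (ae_cst_unique (mA n) (A_gt0 n)); exact: atom_valueP.
Qed.

Lemma ae_atom_value f : measurable_fun setT f ->
  {ae mu, forall x, exists n, A n x /\ f x = atom_value f n}.
Proof.
move=> mf; have fv := ae_foralln (fun n => atom_valueP n mf).
by apply: filterS2 A_cover fv => x [n Anx] fv; exists n; split => //; exact: fv.
Qed.

Lemma lorentz_atomic_isomorphic_ell : isomorphic (lorentz mu p q) (ell q).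
Proof.
have [c [C [c0 cC both]]] := lorentz_norm_equiv_ell b_cvg0 p0 q0 b_gt0 r1 br.
have C0 : 0 < C by exact: lt_le_trans cC.
pose phi (f : T -> R) : nat -> R := fun n => atom_value f n * w n.
have bounds f : measurable_fun setT f ->
    (c%:E * 'N[counting]_(q%:E)[EFin \o phi f] <= lorentz_norm mu p q f)%E /\
    (lorentz_norm mu p q f <= C%:E * 'N[counting]_(q%:E)[EFin \o phi f])%E.
  move=> mf; have fA := ae_atom_value mf.
  by apply/andP; exact: (both _ _ _ _ _ _ mA tA muA mf fA).
have phi_eq f g : measurable_fun setT f -> measurable_fun setT g ->
    phi f = phi g -> forall n, atom_value f n = atom_value g n.
  by move=> mf mg /funeqP fg n; apply: (mulIf (w_neq0 n)); exact: fg.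
exists (phi : lorentz mu p q -> ell q); split.
- move=> f [mf f_fin]; rewrite /=; have [lo _] := bounds f mf.
  rewrite -lee_pdivlMl// in lo; apply: le_lt_trans lo _.
  by rewrite lte_mul_pinfty ?lee_fin ?invr_ge0 ?(ltW c0).
- move=> f g [mf _] [mg _]; split.
  + move=> fg; apply/funext => n; congr (_ * _); apply: atom_value_eq => //.
    by apply: filterS2 fg (atom_valueP n mg) => x fg gv /gv <-; exact: fg.
  + move=> /(phi_eq _ _ mf mg) vfg.
    apply: filterS2 (ae_atom_value mf) (ae_atom_value mg).
    move=> x [n [Anx ->]] [k [Akx ->]] _; rewrite vfg; congr atom_value.
    by apply: (tA I I); exists x.
- move=> a f g [mf _] [mg _]; apply/funext => n.
  rewrite -[RHS]/(a * (atom_value f n * w n) + atom_value g n * w n).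
  rewrite mulrA -mulrDl; congr (_ * _); apply: atom_value_eq.
    apply: measurable_funD => //; exact: measurable_funM.
  apply: filterS2 (atom_valueP n mf) (atom_valueP n mg) => x fv gv Anx.
  by rewrite -(fv Anx) -(gv Anx).
- move=> h h_fin; have [f mf fA] := measurable_glue (fun n => h n / w n) mA tA.
  have phif : phi f = h.
    apply/funext => n; rewrite /phi (@atom_value_eq _ _ (h n / w n))//.
      by rewrite divfK.
    by apply: aeW => x; exact: fA.
  exists f => //; split => //; have [_ up] := bounds f mf.
  apply: le_lt_trans up _; rewrite phif.
  by rewrite lte_mul_pinfty ?lee_fin ?(ltW C0).
- exists C^-1, c^-1; rewrite !invr_gt0; split => // f [mf _].
  have [lo up] := bounds f mf; apply/andP; split.
    by rewrite lee_pdivrMl.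
  by rewrite lee_pdivlMl.
Qed.

End atomic_lorentz.

Theorem proposition4p10 (R : realType) (p q : R) (b : nat -> R)
  (p_gt1 : 1 < p) (q_ge1 : 1 <= q) (p_neq_q : p <> q)
  (b0 : b 0%N = 1) (b_decr : forall n, b n.+1 < b n)
  (b_gt0 : forall n, 0 < b n) (b_cvg0 : b n @[n --> \oo] --> (0 : R))
  (gap_noninc : forall n, b n.+1 - b n.+2 <= b n - b n.+1) :
  let chi (n : nat) : lorentz01 p q := \1_(`]b n.+1, b n]) in
  let B (n : nat) : R := (b n - b n.+1) `^ p^-1 in
  let x (n : nat) : lorentz01 p q := (B n)^-1 *: chi n in
  [/\ forall n, qnorm (chi n) = (B n)%:E,
      sup (range (fun n => b n.+1 / b n)) < 1 ->
        equivalent_seq x (@ell_unit R q),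
      forall (d : measure_display) (Omega : measurableType d)
        (mu : {measure set Omega -> \bar R}) (A : nat -> set Omega),
        purely_atomic mu A ->
        (forall n, mu (A n) = (b n - b n.+1)%:E) ->
        sup (range (fun k => fine (mu (A k.+1)) / fine (mu (A k)))) < 1 ->
        isomorphic (lorentz mu p q) (ell q) &
      b n.+1 / b n @[n --> \oo] --> (1 : R) ->
        ~ equivalent_seq x (@ell_unit R q)].
Proof.
have p0 : 0 < p by exact: lt_trans p_gt1.
have q0 : 0 < q by exact: lt_le_trans q_ge1.
have gap_gt0 n : 0 < b n - b n.+1 by rewrite subr_gt0.
move=> chi B x; split.
- by move=> n; apply: (lorentz01_norm_block b0) => //; exact: leqnSn.
- move=> /(sup_range_lt (M := 1)) [n|r r1 ratio_le].
    by rewrite ler_pdivrMr// mul1r ltW.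
  apply: (blocks_equivalent_ell b0 b_decr b_gt0 b_cvg0 p0 q0 r1) => n.
  by rewrite -ler_pdivrMr.
- move=> d Omega mu A atomicA muA /(sup_range_lt (M := 1)) [n|r r1 ratio_le].
    by rewrite !muA ler_pdivrMr//= mul1r.
  apply: (lorentz_atomic_isomorphic_ell atomicA muA b_decr b_gt0 b_cvg0 p0 q0
    r1).
  apply: ratio_gap_ratio => // n.
  by have := ratio_le n; rewrite !muA /= ler_pdivrMr.
- exact: (blocks_not_equivalent_ell b0 b_decr b_gt0 b_cvg0 p0 q0 p_neq_q).
Qed.
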